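(* Let $\mathcal{H}$ be a real Hilbert space, $A:\mathcal{H}\rightrightarrows\mathcal{H}$ a set-valued operator, $\gamma>0$, and $F:\mathcal{H}\to\mathcal{H}$ single-valued. Let $T_{\gamma A}^F=F\circ(\gamma A+F)^{-1}$ be the transformed resolvent of $\gamma A$ with respect to $F$, assumed to be everywhere defined on $\mathcal{H}$. If $(A,F)\in\mathcal{M}_\alpha$ with $\alpha\geq0$, then $$\mathcal{G}(T_{\gamma A}^F,\mathrm{id})\subseteq D\!\left(\tfrac{1}{2+2\gamma\alpha},\tfrac{1}{2+2\gamma\alpha}\right).$$ In particular, if $\alpha=0$, then $T_{\gamma A}^F$ is firmly nonexpansive; and if $\alpha>0$, then $T_{\gamma A}^F$ is Lipschitz continuous with constant $1/(1+\alpha\gamma)<1$, i.e., contractive.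
   Context: Operators: for $A:\mathcal{H}\rightrightarrows\mathcal{H}$, $\operatorname{gph}A=\{(x,u):u\in A(x)\}$, $\operatorname{dom}A=\{x:A(x)\neq\emptyset\}$, $A^{-1}(u)=\{x:u\in A(x)\}$, $(A\circ B)(x)=\bigcup_{y\in B(x)}A(y)$; sums and scalar multiples are pointwise (Minkowski). A single-valued $F:\mathcal{H}\to\mathcal{H}$ is identified with $x\mapsto\{F(x)\}$. An operator $A$ is firmly nonexpansive if $\langle x-\bar x,u-\bar u\rangle\geq\|u-\bar u\|^2$ for all $(x,u),(\bar x,\bar u)\in\operatorname{gph}A$; $L$-Lipschitz ($L>0$) if $\|u-\bar u\|\leq L\|x-\bar x\|$ for all $(x,u),(\bar x,\bar u)\in\operatorname{gph}A$; contractive if it is $L$-Lipschitz with $L<1$. $\mathcal{M}_\alpha$ is the class of $\alpha$-monotone operator pairs: $(A,B)\in\mathcal{M}_\alpha$ iff $\langle u_A-\bar u_A,u_B-\bar u_B\rangle\geq\alpha\|u_B-\bar u_B\|^2$ for all $(x,u_A),(\bar x,\bar u_A)\in\operatorname{gph}A$ and $(x,u_B),(\bar x,\bar u_B)\in\operatorname{gph}B$. $D(c,r)=\{z\in\mathbb{C}:|z-c|\leq r\}$; $\overline{\mathbb{C}}=\mathbb{C}\cup\{\infty\}$. Scaled relative graph of a pair: for $a,b\in\mathcal{H}$ with $b\neq0$ let $z_\pm(a,b)=\frac{\|a\|}{\|b\|}\exp(\pm i\angle(b,a))$ (a complex-conjugate pair), where $\angle(b,a)=\arccos\frac{\langle b,a\rangle}{\|b\|\|a\|}\in[0,\pi]$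 if $a\neq0$ and $b\neq0$, and $\angle(b,a)=0$ otherwise. For $A,B:\mathcal{H}\rightrightarrows\mathcal{H}$, $\mathcal{G}(A,B)\subseteq\overline{\mathbb{C}}$ consists of all points $z_\pm(u_A-\bar u_A,u_B-\bar u_B)$ (both signs) with $x,\bar x\in\operatorname{dom}A\cap\operatorname{dom}B$, $u_A\in A(x)$, $\bar u_A\in A(\bar x)$, $u_B\in B(x)$, $\bar u_B\in B(\bar x)$ and $u_B\neq\bar u_B$; additionally $\infty\in\mathcal{G}(A,B)$ if and only if there exist $(x,u_A),(\bar x,\bar u_A)\in\operatorname{gph}A$ and $(x,u_B),(\bar x,\bar u_B)\in\operatorname{gph}B$ (possibly $x=\bar x$) with $u_B=\bar u_B$ and $u_A\neq\bar u_A$. *)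

(* Defs.v *)
From mathcomp Require Import all_boot all_order all_algebra.
From mathcomp Require Import sesquilinear complex.
From mathcomp Require Import all_classical all_reals all_analysis.

Set Implicit Arguments.
Unset Strict Implicit.
Unset Printing Implicit Defensive.

Import Order.TTheory GRing.Theory Num.Theory.
Import numFieldNormedType.Exports.

Local Open Scope classical_set_scope.
Local Open Scope ring_scope.

(* A real Hilbert space is a [completeNormedModType R] [H], [R : realType],
   with a dot product [ip : {dot H for idfun}] that induces its norm. *)
Definition induces_norm (R : realType) (H : completeNormedModType R)
    (ip : {dot H for idfun}) : Prop :=
  forall x, `|x| ^+ 2 = ip x x.

Section Operators.
Context {R : realType} {H : completeNormedModType R}.

Definition operator := H -> set H.

Implicit Types (A B : operator) (ip : {dot H for idfun}).

Definition gph A : set (H * H) := [set xu | A xu.1 xu.2].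
Definition dom A : set H := [set x | A x !=set0].
Definition opinv A : operator := fun u => [set x | A x u].
Definition opcomp A B : operator := fun x => \bigcup_(y in B x) A y.
Definition opadd A B : operator := fun x => [set u + v | u in A x & v in B x].
Definition opscale (c : R) A : operator := fun x => [set c *: u | u in A x].
Definition single (F : H -> H) : operator := fun x => [set F x].

Definition transformed_resolvent A (F : H -> H) : operator :=
  opcomp (single F) (opinv (opadd A (single F))).

Definition firmly_nonexpansive ip A : Prop :=
  forall x u x' u', gph A (x, u) -> gph A (x', u') ->
    `|u - u'| ^+ 2 <= ip (x - x') (u - u').

Definition op_lipschitz (L : R) A : Prop :=
  0 < L /\
  forall x u x' u', gph A (x, u) -> gph A (x', u') ->
    `|u - u'| <= L * `|x - x'|.

Definition contractive A : Prop := exists2 L, L < 1 & op_lipschitz L A.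

Definition monotone_pair ip (alpha : R) : set (operator * operator) :=
  [set AB | forall x uA uB x' uA' uB',
     gph AB.1 (x, uA) -> gph AB.1 (x', uA') ->
     gph AB.2 (x, uB) -> gph AB.2 (x', uB') ->
     alpha * `|uB - uB'| ^+ 2 <= ip (uA - uA') (uB - uB')].

End Operators.

Arguments operator {R} H.

Section ScaledRelativeGraph.
Context {R : realType} {H : completeNormedModType R}.
Implicit Types (A B : operator H) (ip : {dot H for idfun}).

(* [r] is real; the order on [R[i]] compares real numbers as in [R]. *)
Definition disk (c : R[i]) (r : R) : set R[i] := [set z | `|z - c| <= r%:C%C].

(* [None] is the point at infinity. *)
Definition extended_complex : Type := one_point_compactification R[i].

Definition expi (t : R) : R[i] := (cos t +i* sin t)%C.

Definition angle ip (b a : H) : R :=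
  if (a != 0) && (b != 0) then acos (ip b a / (`|b| * `|a|)) else 0.

(* The sign of the exponent is [+] for [s = false] and [-] for [s = true]. *)
Definition zpm ip (s : bool) (a b : H) : R[i] :=
  (`|a| / `|b|)%:C%C * expi ((-1) ^+ s * angle ip b a).

Definition srg ip A B : set extended_complex :=
  [set z | match z with
   | Some w => exists x x' uA uA' uB uB' s,
       [/\ (dom A `&` dom B) x /\ (dom A `&` dom B) x',
           A x uA /\ A x' uA', B x uB /\ B x' uB', uB <> uB' &
           w = zpm ip s (uA - uA') (uB - uB')]
   | None => exists x x' uA uA' uB uB',
       [/\ gph A (x, uA) /\ gph A (x', uA'),
           gph B (x, uB) /\ gph B (x', uB'), uB = uB' & uA <> uA']
   end].

End ScaledRelativeGraph.
Arguments extended_complex R : clear implicits.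

(* Main.v *)
(** A pair of points [(x, u)], [(x', u')] of the transformed resolvent comes
    from [x - x' = gamma da + (u - u')] with [da] a difference of values of [A]
    and [u - u'] the matching difference of values of [F], so
    alpha-monotonicity gives
    [(1 + alpha gamma) |u - u'|^2 <= <x - x', u - u'>].
    Divided by [|x - x'|^2] this reads [|z|^2 <= 2 r Re z] for the points [z]
    of the scaled relative graph, which is the equation of the disk [D(r, r)]. *)
Require Import Defs.
From mathcomp Require Import all_boot all_order all_algebra.
From mathcomp Require Import sesquilinear complex.
From mathcomp Require Import all_classical all_reals all_analysis.
From mathcomp Require Import ring lra.

Import Order.TTheory GRing.Theory Num.Theory.
Import numFieldNormedType.Exports.

Local Open Scope classical_set_scope.
Local Open Scope ring_scope.

Section InnerProduct.
Context {R : realType} {H : completeNormedModType R}.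
Context {ip : {dot H for idfun}} (ip_norm : induces_norm ip).

Lemma ip_sym (x y : H) : ip x y = ip y x.
Proof. by rewrite hermC expr0 mul1r. Qed.

(* Obtained by squaring the triangle inequality. *)
Lemma ip_le_norm (x y : H) : ip x y <= `|x| * `|y|.
Proof.
have : `|x + y| ^+ 2 <= (`|x| + `|y|) ^+ 2.
  by rewrite lerXn2r ?nnegrE ?addr_ge0 ?normr_ge0 ?ler_normD.
rewrite ip_norm linearDl !linearDr /= -!ip_norm (ip_sym y x).
by move: `|x| `|y| (ip x y) => p q c; lra.
Qed.

Lemma normr_ip_le (x y : H) : `|ip x y| <= `|x| * `|y|.
Proof.
rewrite ler_norml ip_le_norm andbT lerNl -(normrN y) -linearNr.
exact: ip_le_norm.
Qed.

(** This is the real part of [zpm ip s a b]. For [a = 0] both sides vanish; otherwise Cauchy-Schwarz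
    puts the cosine quotient in $[-1,1]$, where [cos] inverts [acos]. *)
Lemma norm_cos_angle {a b : H} : b != 0 ->
  `|a| / `|b| * cos (angle ip b a) = ip b a / `|b| ^+ 2.
Proof.
move=> b_neq0; rewrite /angle b_neq0 andbT.
have [->|a_neq0] := eqVneq a 0; first by rewrite normr0 linear0r !mul0r.
have nb : `|b| != 0 by rewrite normr_eq0.
have na : `|a| != 0 by rewrite normr_eq0.
rewrite acosK; last first.
  rewrite in_itv /= -ler_norml normrM normfV ler_pdivrMr ?normr_gt0 ?mulf_neq0//.
  by rewrite mul1r normrM !normr_id normr_ip_le.
by field; rewrite nb na.
Qed.

End InnerProduct.

Section Disk.
Context {R : realType}.

(** Expand $|\rho e^{it}-r|^2=\rho^2-2r\rho\cos t+r^2$ and compare with $r^2$. *)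
Lemma polar_in_disk (rho t r : R) : 0 <= r ->
  rho ^+ 2 <= 2 * r * (rho * cos t) ->
  disk r%:C%C r (rho%:C%C * expi t).
Proof.
move=> r_ge0 le_rho; rewrite /disk /= normc_def lecR /=.
rewrite -{2}(ger0_norm r_ge0) -sqrtr_sqr ler_wsqrtr//.
have := cos2Dsin2 t; nra.
Qed.

End Disk.

Section TransformedResolvent.
Context {R : realType} {H : completeNormedModType R}.
Context {ip : {dot H for idfun}} (ip_norm : induces_norm ip).
Context {A : operator H} {F : H -> H} {gamma alpha : R}.
Context (gamma_gt0 : 0 < gamma) (alpha_ge0 : 0 <= alpha).
Context (AF : monotone_pair ip alpha (A, single F)).
Let T := transformed_resolvent (opscale gamma A) F.

Lemma transformed_resolventP {x u} :
  T x u -> exists y a, [/\ A y a, u = F y & x = gamma *: a + F y].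
Proof. by case=> y [_ [a Aya <-] [_ -> <-]] ->; exists y, a. Qed.

Lemma transformed_resolvent_cocoercive {x u x' u'} : T x u -> T x' u' ->
  (1 + alpha * gamma) * `|u - u'| ^+ 2 <= ip (x - x') (u - u').
Proof.
move=> /transformed_resolventP[y [a [Aya -> ->]]].
move=> /transformed_resolventP[y' [a' [Aya' -> ->]]].
(* Regroup $x-x'$ as $\gamma(a-a')+(Fy-Fy')$; pairing the second summand with $u-u'=Fy-Fy'$ gives
   $\|u-u'\|^2$. *)
rewrite opprD addrACA -scalerBr (linearDl ip) (linearZl_LR ip) /= -ip_norm.
have := AF y a (F y) y' a' (F y') Aya Aya' erefl erefl.
move=> /(ler_wpM2l (ltW gamma_gt0)) /=.
by move: (ip _ _) (`|_| ^+ 2) => p q; lra.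
Qed.

(** Bound the inner product in the cocoercivity estimate by Cauchy-Schwarz, then cancel one factor
    $\|u-u'\|$ when it is nonzero. *)
Lemma transformed_resolvent_lipschitz :
  op_lipschitz (1 / (1 + alpha * gamma)) T.
Proof.
have k_gt0 : 0 < 1 + alpha * gamma by rewrite ltr_pwDl// mulr_ge0// ltW.
split=> [|x u x' u' Txu Txu']; first by rewrite divr_gt0.
rewrite mul1r mulrC ler_pdivlMr//.
have [->|du_neq0] := eqVneq (u - u') 0; first by rewrite normr0 mul0r.
have du_gt0 : 0 < `|u - u'| by rewrite normr_gt0.
rewrite -(ler_pM2r du_gt0) (le_trans _ (ip_le_norm ip_norm _ _))//.
by rewrite mulrAC -expr2 mulrC transformed_resolvent_cocoercive.
Qed.

Lemma srg_transformed_resolvent :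
  let r := 1 / (2 + 2 * gamma * alpha) in
  srg ip T (single id) `<=` Some @` disk r%:C%C r.
Proof.
have k_gt0 : 0 < 1 + alpha * gamma by rewrite ltr_pwDl// mulr_ge0// ltW.
move=> r [w|] /=; last first.
  (* The point at infinity would need two distinct values of [T] at one point; cocoercivity with
     $x=x'$ forces $u=u'$. *)
  case=> x [x' [u [u' [uB [uB' [[Txu Txu'] [eB eB'] eBB' u_neq]]]]]].
  have xx' : x = x' := etrans (esym eB) (etrans eBB' eB').
  rewrite -xx' in Txu'.
  have := transformed_resolvent_cocoercive Txu Txu'.
  rewrite subrr linear0l pmulr_rle0// => du_le0.
  exfalso; apply: u_neq; apply/eqP; rewrite -subr_eq0 -normr_eq0 -sqrf_eq0.
  by rewrite eq_le du_le0 sqr_ge0.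
case=> x [x' [u [u' [uB [uB' [s [_ [Txu Txu'] [-> ->] x_neq ->]]]]]]].
have dx_neq0 : x - x' != 0 by rewrite subr_eq0; apply/eqP.
eexists; last by [].
have rE : 2 * r = (1 + alpha * gamma)^-1.
  by rewrite /r; field; rewrite !gt_eqF//; nra.
rewrite /zpm; apply: polar_in_disk; first by rewrite divr_ge0//; nra.
(* Cosine is even, so both conjugate points are treated at once. *)
have -> : cos ((-1) ^+ s * angle ip (x - x') (u - u')) =
          cos (angle ip (x - x') (u - u')).
  by case: s; rewrite ?expr1 ?mulN1r ?cosN// expr0 mul1r.
(* Cancelling $\|x-x'\|^{-2}$ from both sides leaves the cocoercivity estimate. *)
rewrite norm_cos_angle// rE expr_div_n mulrA ler_pM2r; last first.
  by rewrite invr_gt0 exprn_gt0// normr_gt0.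
by rewrite ler_pdivlMl// transformed_resolvent_cocoercive.
Qed.

End TransformedResolvent.

Theorem mainTheorem5 (R : realType) (H : completeNormedModType R)
    (ip : {dot H for idfun}) (ip_norm : induces_norm ip)
    (A : operator H) (F : H -> H) (gamma alpha : R)
    (gamma_gt0 : 0 < gamma) (alpha_ge0 : 0 <= alpha)
    (domT : dom (transformed_resolvent (opscale gamma A) F) = setT)
    (AF : monotone_pair ip alpha (A, single F)) :
  let T := transformed_resolvent (opscale gamma A) F in
  let r := 1 / (2 + 2 * gamma * alpha) in
  let L := 1 / (1 + alpha * gamma) in
  [/\ srg ip T (single id) `<=` Some @` disk r%:C%C r,
      alpha = 0 -> firmly_nonexpansive ip T &
      0 < alpha -> [/\ op_lipschitz L T, L < 1 & contractive T]].
Proof.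
move=> T r L; split=> [|alpha0 x u x' u' Txu Txu'|alpha_gt0].
- exact: srg_transformed_resolvent.
- have := transformed_resolvent_cocoercive ip_norm gamma_gt0 AF Txu Txu'.
  by rewrite alpha0 mul0r addr0 mul1r.
- have lipT : op_lipschitz L T by exact: transformed_resolvent_lipschitz.
  (* Here $\alpha\gamma>0$, so the denominator exceeds 1. *)
  have L_lt1 : L < 1 by rewrite /L ltr_pdivrMr ?mul1r; nra.
  by split=> //; exists L.
Qed.
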